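(* For all $n\ge2$ and $P,Q\in\Gamma_n$, $$T(P\Vert Q)\le\tfrac18\mathcal V_t(P\Vert Q)\quad\text{for } t\ge2\text{ or }t\le-1,\qquad T(P\Vert Q)\ge\tfrac18\mathcal V_t(P\Vert Q)\quad\text{for }0\le t\le1.$$
   Context: $\Gamma_n=\{P=(p_1,\dots,p_n): p_i>0,\ \sum_{i=1}^n p_i=1\}$. For $P,Q\in\Gamma_n$, the arithmetic-geometric divergence is $T(P\Vert Q)=\sum_{i=1}^n\left(\frac{p_i+q_i}{2}\right)\ln\left(\frac{p_i+q_i}{2\sqrt{p_iq_i}}\right)$, and $$\mathcal V_t(P\Vert Q)=\begin{cases}[t(t-1)]^{-1}\left[\sum_{i=1}^n\left(p_i^tq_i^{1-t}+p_i^{1-t}q_i^t\right)-2\right], & t\ne0,1,\\ \sum_{i=1}^n(p_i-q_i)\ln\left(\frac{p_i}{q_i}\right), & t=0,1.\end{cases}$$ *)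

(* Defs.v *)
From mathcomp Require Import all_boot all_order all_algebra.
From mathcomp Require Import all_classical all_reals all_analysis.

Set Implicit Arguments.
Unset Strict Implicit.
Unset Printing Implicit Defensive.

Import Order.TTheory GRing.Theory Num.Theory.

Local Open Scope classical_set_scope.
Local Open Scope ring_scope.

Definition Gamma (R : realType) (n : nat) : set ('I_n -> R) :=
  [set P | (forall i, 0 < P i) /\ \sum_(i < n) P i = 1].

Arguments Gamma : clear implicits.

(* The arithmetic-geometric divergence T(P || Q). *)
Definition agDiv (R : realType) (n : nat) (P Q : 'I_n -> R) : R :=
  \sum_(i < n) (P i + Q i) / 2 * ln ((P i + Q i) / (2 * Num.sqrt (P i * Q i))).

(* The family V_t(P || Q). Its value at t = 0 and t = 1 (the common limit of
   the generic formula) is the J-divergence. *)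
Definition symDiv (R : realType) (n : nat) (t : R) (P Q : 'I_n -> R) : R :=
  if (t == 0) || (t == 1) then
    \sum_(i < n) (P i - Q i) * ln (P i / Q i)
  else
    (t * (t - 1))^-1 *
    (\sum_(i < n) (P i `^ t * Q i `^ (1 - t) + P i `^ (1 - t) * Q i `^ t) - 2).

(* Main.v *)
Require Import Defs.
From mathcomp Require Import all_boot all_order all_algebra.
From mathcomp Require Import all_classical all_reals all_analysis.
From mathcomp Require Import ring lra.

Import Order.TTheory GRing.Theory Num.Theory.
Import numFieldNormedType.Exports.

Local Open Scope classical_set_scope.
Local Open Scope ring_scope.

(** Both divergences are Csiszar f-divergences: with x = p_i / q_i they are sums
    of q_i * f (x) ([agDiv_generator], [symDiv_generator]), where the generator
    f vanishes to second order at 1 and is therefore determined by its second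
    derivative ([agGen_curvature], [symGen_curvature]):
      - for T, f'' (x) = (x^2 + 1) / (4 x^2 (x + 1));
      - for V_t, f'' (x) = x^(t-2) + x^(-1-t) = (x^t + x^(1-t)) / x^2, for every
        t, the exceptional values 0 and 1 included.
    A pointwise comparison of second derivatives passes to the generators
    ([curvature_le]), hence to the divergences. After multiplication by 8 x^2,
    it remains to compare 2 (x^2 + 1) / (x + 1) with x^t + x^(1-t).

    Since x^a - 1 and x^b - 1 have the same sign when a and b do, two
    factorisations decide this ([powR_sum_le], [powR_sum_ge]):
      - 1 + x - x^t - x^(1-t) = (x^t - 1) (x^(1-t) - 1), which is nonnegative
        for t in [0, 1], while 1 + x <= 2 (x^2 + 1) / (x + 1);
      - x^t + x^(1-t) - x^2 - 1/x = x^(1-t) (x^(t-2) - 1) (x^(t+1) - 1), which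
        is nonnegative for t outside ]-1, 2[, while
        x^2 + 1/x >= 2 (x^2 + 1) / (x + 1). *)

(** * Comparison of functions through their second derivatives *)

(** Such an f, if it exists, is unique on the positive half-line: it is the
    double primitive of c based at 1. *)
Definition curvature (R : realType) (f c : R -> R) : Prop :=
  exists2 f' : R -> R, f 1 = 0 /\ f' 1 = 0 &
    forall x : R, 0 < x -> is_derive x 1 f (f' x) /\ is_derive x 1 f' (c x).

Lemma mvt_from1 (R : realType) (h h' : R -> R) (x : R) :
  (forall y : R, 0 < y -> is_derive y 1 h (h' y)) -> 0 < x ->
  exists c, [/\ 0 < c, h x - h 1 = h' c * (x - 1) & 0 <= (c - 1) * (x - 1)].
Proof.
move=> dh x0.
have cont a b : 0 < a -> {within `[a, b], continuous h}.
  move=> a0; apply: derivable_within_continuous => y.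
  rewrite in_itv/= => /andP[ay _].
  by have [] := dh y (lt_le_trans a0 ay).
have [x1|x1|->] := ltgtP x 1; last by exists 1; rewrite ltr01 !subrr !mulr0.
- have [c|c + e] := @MVT R h h' _ _ x1 _ (cont x 1 x0).
    by rewrite in_itv/= => /andP[xc _]; apply: dh; exact: lt_trans xc.
  rewrite in_itv/= => /andP[xc c1].
  exists c; split; first exact: lt_trans xc.
    by rewrite -opprB e -mulrN opprB.
  by nra.
- have [c|c + e] := @MVT R h h' _ _ x1 _ (cont 1 x ltr01).
    by rewrite in_itv/= => /andP[xc _]; apply: dh; exact: lt_trans xc.
  rewrite in_itv/= => /andP[xc c1].
  exists c; split => //; first exact: lt_trans xc.
  by nra.
Qed.

(** Two applications of the mean value theorem: h'' >= 0 makes h' (c) have the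
    sign of c - 1, so h decreases to its value at 1 and increases after it. *)
Lemma curvature_ge0 (R : realType) (h c : R -> R) (x : R) :
  curvature R h c -> (forall y, 0 < y -> 0 <= c y) -> 0 < x -> 0 <= h x.
Proof.
move=> [h' [h1 h'1] dh] c0 x0.
have [y [y0 ey yx]] := @mvt_from1 R h h' x (fun z z0 => proj1 (dh z z0)) x0.
have [z [z0 ez _]] := @mvt_from1 R h' c y (fun z z0 => proj2 (dh z z0)) y0.
rewrite h1 subr0 in ey; rewrite h'1 subr0 in ez.
by rewrite ey ez -mulrA mulr_ge0// c0.
Qed.

Lemma curvature_le (R : realType) (f g cf cg : R -> R) (a b x : R) :
  curvature R f cf -> curvature R g cg ->
  (forall y, 0 < y -> a * cf y <= b * cg y) -> 0 < x -> a * f x <= b * g x.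
Proof.
move=> [f' [f1 f'1] df] [g' [g1 g'1] dg] cfg x0.
rewrite -subr_ge0.
apply: (@curvature_ge0 R (b \*: g - a \*: f) (b \*: cg - a \*: cf) x) => //.
  exists (b \*: g' - a \*: f').
    by rewrite !fctE /= f1 f'1 g1 g'1 !scaler0 !subr0.
  move=> y y0; have [df1 df2] := df y y0; have [dg1 dg2] := dg y y0.
  by split; apply: is_deriveB.
by move=> y y0; rewrite !fctE subr_ge0; exact: cfg.
Qed.

(** * The two generators *)

(** f (x) = (x + 1)/2 ln ((x + 1) / (2 sqrt x)), with the logarithm split
    so that no square root has to be differentiated. *)
Definition agGen (R : realType) (x : R) : R :=
  (x + 1) / 2 * (ln ((x + 1) / 2) - ln x / 2).

(** Subtracting 1 + x, the common value of x^t + x^(1-t) at t = 0 and t = 1,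
    makes the function and its derivative vanish at x = 1. *)
Definition symGen (R : realType) (t x : R) : R :=
  if (t == 0) || (t == 1) then (x - 1) * ln x
  else (t * (t - 1))^-1 * (x `^ t + x `^ (1 - t) - 1 - x).

Lemma is_derive_lnD1 (R : realType) (x : R) : 0 < x ->
  is_derive x 1 (fun y : R => ln ((y + 1) / 2) - ln y / 2)
    ((x + 1)^-1 - x^-1 / 2).
Proof.
move=> x0; have x1 : 0 < x + 1 by rewrite addr_gt0.
have dl : is_derive x 1 (2^-1 \*: (id + cst 1) : R -> R) 2^-1.
  apply: (is_derive_eq (is_deriveZ _ (is_deriveD (is_derive_id _ _) _))).
  by rewrite addr0 scaler1.
have dln : is_derive ((2^-1 \*: (id + cst 1) : R -> R) x) 1 (@ln R) (2 / (x + 1)).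
  have y0 : 0 < (2^-1 \*: (id + cst 1) : R -> R) x.
    by rewrite !fctE /GRing.scale/= mulr_gt0.
  apply: (is_derive_eq (is_derive1_ln y0)).
  by rewrite !fctE/= /GRing.scale/= /GRing.scale/=; field; rewrite (gt_eqF x1).
have -> : (fun y : R => ln ((y + 1) / 2) - ln y / 2) =
    (@ln R \o (2^-1 \*: (id + cst 1) : R -> R)) - 2^-1 \*: @ln R.
  by apply/funext => y; congr (ln _ - _); rewrite mulrC.
apply: (is_derive_eq (is_deriveB (is_derive1_comp dln dl)
  (is_deriveZ _ (is_derive1_ln x0)))).
by rewrite /GRing.scale/=; field; rewrite ?(gt_eqF x0) ?(gt_eqF x1).
Qed.

Lemma is_derive_inv (R : realType) (x : R) : 0 < x ->
  is_derive x 1 (fun y : R => y^-1) (- x^-1 ^+ 2).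
Proof.
move=> x0; have xN0 : id x != 0 :> R by rewrite gt_eqF.
apply: (is_derive_eq (is_deriveV xN0 (is_derive_id _ _))).
by rewrite /GRing.scale/= mulr1 exprVn.
Qed.

Lemma agGen_curvature (R : realType) :
  curvature R (agGen R) (fun x => (x ^+ 2 + 1) / (4 * x ^+ 2 * (x + 1))).
Proof.
exists (fun x => 2^-1 * (ln ((x + 1) / 2) - ln x / 2) + (4^-1 - 4^-1 * x^-1)).
  rewrite /agGen (_ : (1 + 1) / 2 = 1 :> R) ?ln1; last by field.
  by rewrite mul0r subrr !mulr0 invr1 mulr1 subrr addr0.
move=> x x0; have x1 : 0 < x + 1 by rewrite addr_gt0.
have dl := @is_derive_lnD1 R x x0; split.
- have -> : agGen R = (2^-1 \*: (id + cst 1)) *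
      (fun y : R => ln ((y + 1) / 2) - ln y / 2).
    by apply/funext => y; congr (_ * _); rewrite mulrC.
  have dg := is_deriveM (is_deriveZ 2^-1
      (is_deriveD (is_derive_id x 1) (is_derive_cst (1 : R) x 1))) dl.
  apply: (is_derive_eq dg); rewrite !fctE/= /GRing.scale/= /GRing.scale/=.
  by field; rewrite ?(gt_eqF x0) ?(gt_eqF x1).
- have -> : (fun x : R =>
        2^-1 * (ln ((x + 1) / 2) - ln x / 2) + (4^-1 - 4^-1 * x^-1)) =
      (2^-1 \*: (fun y : R => ln ((y + 1) / 2) - ln y / 2)) +
      (cst 4^-1 - 4^-1 \*: (fun y : R => y^-1)).
    by apply/funext.
  have di := @is_derive_inv R x x0.
  have dg := is_deriveD (is_deriveZ 2^-1 dl)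
    (is_deriveB (is_derive_cst (4^-1 : R) x 1) (is_deriveZ 4^-1 di)).
  apply: (is_derive_eq dg); rewrite /GRing.scale/=.
  by field; rewrite ?(gt_eqF x0) ?(gt_eqF x1).
Qed.

Lemma symGen_curvature (R : realType) (t : R) :
  curvature R (symGen R t) (fun x => x `^ (t - 2) + x `^ (- 1 - t)).
Proof.
have [t01|t01] := boolP ((t == 0) || (t == 1)).
- exists (fun x => ln x + (1 - x^-1)).
    by rewrite /symGen t01 ln1 invr1 subrr mulr0 addr0.
  move=> x x0; have dl := @is_derive1_ln R x x0; split.
  + have -> : symGen R t = (id - cst 1) * @ln R.
      by apply/funext => y; rewrite /symGen t01.
    have dg := is_deriveM
      (is_deriveB (is_derive_id x 1) (is_derive_cst (1 : R) x 1)) dl.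
    apply: (is_derive_eq dg); rewrite !fctE/= /GRing.scale/=.
    by field; rewrite ?(gt_eqF x0) ?(gt_eqF x1).
  + have -> : (fun x : R => ln x + (1 - x^-1)) =
        @ln R + (cst 1 - (fun y : R => y^-1)) by apply/funext.
    have di := @is_derive_inv R x x0.
    have dg := is_deriveD dl (is_deriveB (is_derive_cst (1 : R) x 1) di).
    apply: (is_derive_eq dg).
    have x2 : x `^ (- 2) = x^-1 ^+ 2.
      by rewrite exprVn -(@powR_invn _ x 2) ?ltW.
    have x1 : x `^ (- 1) = x^-1 by rewrite powR_inv1 ?ltW.
    case/orP: t01 => /eqP ->.
      by rewrite !sub0r subr0 x2 x1; ring.
    by rewrite (_ : 1 - 2 = - 1); [rewrite (_ : - 1 - 1 = - 2) ?x2 ?x1; ring|ring].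
- have [t0 t1] : t != 0 /\ t - 1 != 0.
    by rewrite subr_eq0; move: t01; rewrite negb_or => /andP.
  exists (fun x => (t * (t - 1))^-1 *
      (t * x `^ (t - 1) + (1 - t) * x `^ (- t) - 1)).
    by rewrite /symGen (negbTE t01) !powR1; split; ring.
  move=> x x0; split.
  + have -> : symGen R t = (t * (t - 1))^-1 \*:
        (@powR R ^~ t + @powR R ^~ (1 - t) - cst 1 - id).
      by apply/funext => y; rewrite /symGen (negbTE t01).
    have d1 := @is_derive1_powR R t x x0.
    have d2 := @is_derive1_powR R (1 - t) x x0.
    have dg := is_deriveZ (t * (t - 1))^-1 (is_deriveB (is_deriveB
      (is_deriveD d1 d2) (is_derive_cst (1 : R) x 1)) (is_derive_id x 1)).
    apply: (is_derive_eq dg); rewrite /GRing.scale/=.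
    rewrite (_ : 1 - t - 1 = - t); last by ring.
    by rewrite subr0.
  + have -> : (fun x => (t * (t - 1))^-1 *
        (t * x `^ (t - 1) + (1 - t) * x `^ (- t) - 1)) =
        (t * (t - 1))^-1 \*:
        (t \*: @powR R ^~ (t - 1) + (1 - t) \*: @powR R ^~ (- t) - cst 1).
      by apply/funext.
    have d1 := @is_derive1_powR R (t - 1) x x0.
    have d2 := @is_derive1_powR R (- t) x x0.
    have dg := is_deriveZ (t * (t - 1))^-1 (is_deriveB
      (is_deriveD (is_deriveZ t d1) (is_deriveZ (1 - t) d2))
      (is_derive_cst (1 : R) x 1)).
    apply: (is_derive_eq dg); rewrite /GRing.scale/= /GRing.scale/=.
    rewrite (_ : t - 1 - 1 = t - 2); last by ring.
    rewrite (_ : - t - 1 = - 1 - t); last by ring.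
    by field; rewrite t0 t1.
Qed.

(** * Inequalities between powers *)

(** The sign of x^a - 1 is that of a ln x, so the sign of the product is that of
    a b (ln x)^2. *)
Lemma powR_sub1_mul_ge0 (R : realType) (x a b : R) :
  0 < x -> 0 <= a * b -> 0 <= (x `^ a - 1) * (x `^ b - 1).
Proof.
move=> x0 ab.
rewrite /powR gt_eqF//.
have abl : 0 <= (a * ln x) * (b * ln x).
  by rewrite mulrACA mulr_ge0// -expr2 sqr_ge0.
have [la|la|<-] := ltgtP 0 (a * ln x); last by rewrite expR0 subrr mul0r.
- rewrite pmulr_rge0 // in abl.
  by rewrite mulr_ge0// subr_ge0 -expR0 ler_expR// ltW.
- rewrite nmulr_rge0 // in abl.
  by rewrite mulr_le0// subr_le0 -expR0 ler_expR// ltW.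
Qed.

(** From (x^t - 1) (x^(1-t) - 1) >= 0 one gets the bound 1 + x, and
    2 (x^2 + 1) - (x + 1)^2 = (x - 1)^2. *)
Lemma powR_sum_le (R : realType) (t x : R) : 0 <= t <= 1 -> 0 < x ->
  x `^ t + x `^ (1 - t) <= 2 * (x ^+ 2 + 1) / (x + 1).
Proof.
move=> /andP[t0 t1] x0; have x1 : 0 < x + 1 by rewrite addr_gt0.
have := @powR_sub1_mul_ge0 R x t (1 - t) x0.
rewrite mulr_ge0 ?subr_ge0// => /(_ isT).
rewrite mulrBl mulrBr -powRD ?(gt_eqF x0) ?implybT//.
rewrite (_ : t + (1 - t) = 1) ?powRr1 ?(ltW x0)//; last by ring.
move=> h; apply: (@le_trans _ _ (1 + x)); first by lra.
by rewrite ler_pdivlMr//; have := sqr_ge0 (x - 1); nra.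
Qed.

(** The hypothesis on t says (t - 2) (t + 1) >= 0, so that
    (x^(t-2) - 1) (x^(t+1) - 1) >= 0. Multiplied by x^(1-t), this is the bound
    x^2 + 1/x, and the rest is the polynomial inequality
    (x^3 + 1) (x + 1) - 2 x (x^2 + 1) = (x - 1)^2 (x^2 + x + 1) >= 0. *)
Lemma powR_sum_ge (R : realType) (t x : R) : 2 <= t \/ t <= -1 -> 0 < x ->
  2 * (x ^+ 2 + 1) / (x + 1) <= x `^ t + x `^ (1 - t).
Proof.
move=> ht x0; have x1 : 0 < x + 1 by rewrite addr_gt0.
have := @powR_sub1_mul_ge0 R x (t - 2) (t + 1) x0.
have -> : 0 <= (t - 2) * (t + 1) by case: ht => ht; nra.
move=> /(_ isT) /(mulr_ge0 (powR_ge0 x (1 - t))).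
have xn0 b : b ==> (x != 0) by rewrite gt_eqF ?implybT.
rewrite mulrBl !mulrBr mul1r !mulr1 -!powRD//.
rewrite (_ : 1 - t + (t - 2 + (t + 1)) = t); last by ring.
rewrite (_ : 1 - t + (t - 2) = - 1); last by ring.
rewrite (_ : 1 - t + (t + 1) = 2); last by ring.
rewrite powR_inv1 ?(ltW x0)// (@powR_mulrn _ x 2) ?(ltW x0)// => h.
apply: (@le_trans _ _ (x ^+ 2 + x^-1)); last by lra.
rewrite -subr_ge0 (_ : _ - _ =
    (x - 1) ^+ 2 * (x ^+ 2 + x + 1) / (x * (x + 1))); last first.
  by field; rewrite ?(gt_eqF x0) ?(gt_eqF x1).
apply: divr_ge0; last by rewrite mulr_ge0 ?ltW.
by rewrite mulr_ge0 ?sqr_ge0//; nra.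
Qed.

(** * Comparison of the divergences *)

Lemma symGen_curvatureE (R : realType) (t x : R) : 0 < x ->
  x `^ (t - 2) + x `^ (- 1 - t) = (x `^ t + x `^ (1 - t)) / x ^+ 2.
Proof.
move=> x0; have xn0 b : b ==> (x != 0) by rewrite gt_eqF ?implybT.
rewrite mulrDl -(@powR_mulrn _ x 2) ?(ltW x0)// -!powRB//.
by congr (_ + x `^ _); ring.
Qed.

Lemma agGen_curvatureE (R : realType) (x : R) : 0 < x ->
  8 * ((x ^+ 2 + 1) / (4 * x ^+ 2 * (x + 1))) =
  (2 * (x ^+ 2 + 1) / (x + 1)) / x ^+ 2.
Proof.
move=> x0; have x1 : 0 < x + 1 by rewrite addr_gt0.
by field; rewrite ?(gt_eqF x0) ?(gt_eqF x1).
Qed.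

Lemma agGen_le (R : realType) (t x : R) : 2 <= t \/ t <= -1 -> 0 < x ->
  8 * agGen R x <= 1 * symGen R t x.
Proof.
move=> ht; apply: curvature_le (agGen_curvature R) (symGen_curvature R t) _.
move=> y y0; rewrite mul1r agGen_curvatureE// symGen_curvatureE//.
by rewrite ler_pM2r ?invr_gt0 ?exprn_gt0//; exact: powR_sum_ge.
Qed.

Lemma agGen_ge (R : realType) (t x : R) : 0 <= t <= 1 -> 0 < x ->
  1 * symGen R t x <= 8 * agGen R x.
Proof.
move=> ht; apply: curvature_le (symGen_curvature R t) (agGen_curvature R) _.
move=> y y0; rewrite mul1r agGen_curvatureE// symGen_curvatureE//.
by rewrite ler_pM2r ?invr_gt0 ?exprn_gt0//; exact: powR_sum_le.
Qed.

Lemma agDiv_generator (R : realType) (n : nat) (P Q : 'I_n -> R) :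
  Gamma R n P -> Gamma R n Q ->
  agDiv P Q = \sum_(i < n) Q i * agGen R (P i / Q i).
Proof.
move=> [P0 _] [Q0 _]; apply: eq_bigr => i _.
have [p0 q0] := (P0 i, Q0 i); have pq0 := divr_gt0 p0 q0.
have s0 : 0 < Num.sqrt (P i / Q i) by rewrite sqrtr_gt0.
have -> : Num.sqrt (P i * Q i) = Q i * Num.sqrt (P i / Q i).
  have -> : P i * Q i = Q i ^+ 2 * (P i / Q i) by field; rewrite gt_eqF.
  by rewrite sqrtrM ?sqr_ge0// sqrtr_sqr gtr0_norm.
rewrite /agGen; have -> : ln (P i / Q i) / 2 = ln (Num.sqrt (P i / Q i)).
  by rewrite -powR12_sqrt ?ltW// ln_powR mulrC.
rewrite -ln_div ?posrE ?divr_gt0 ?addr_gt0//.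
have -> : (P i + Q i) / (2 * (Q i * Num.sqrt (P i / Q i))) =
    (P i / Q i + 1) / 2 / Num.sqrt (P i / Q i).
  by field; rewrite ?(gt_eqF s0) ?(gt_eqF q0).
by rewrite mulrA; congr (_ * _); field; rewrite gt_eqF.
Qed.

Lemma mulr_powR_div (R : realType) (p q t : R) : 0 < p -> 0 < q ->
  q * (p / q) `^ t = p `^ t * q `^ (1 - t).
Proof.
move=> p0 q0; rewrite powRM ?invr_ge0 ?ltW// mulrCA; congr (_ * _).
rewrite -powR_inv1 ?ltW// -powRrM mulN1r powRB ?(gt_eqF q0) ?implybT//.
by rewrite powRr1 ?ltW// powRN.
Qed.

(** Outside t = 0, 1 the generator contains -1 - x, whose contribution to the sum
    is - sum (p_i + q_i) = -2; this is where the normalisation of P and Q is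
    needed. *)
Lemma symDiv_generator (R : realType) (n : nat) (t : R) (P Q : 'I_n -> R) :
  Gamma R n P -> Gamma R n Q ->
  symDiv t P Q = \sum_(i < n) Q i * symGen R t (P i / Q i).
Proof.
move=> [P0 sP] [Q0 sQ]; rewrite /symDiv /symGen.
case: ifP => _.
  apply: eq_bigr => i _; rewrite mulrA; congr (_ * _).
  by field; rewrite gt_eqF.
rewrite (_ : 2 = \sum_(i < n) (P i + Q i)); last by rewrite big_split/= sP sQ.
rewrite -sumrB mulr_sumr; apply: eq_bigr => i _.
rewrite mulrCA; congr (_ * _).
have := @mulr_powR_div R _ _ (1 - t) (P0 i) (Q0 i).
rewrite (_ : 1 - (1 - t) = t) => [<-|]; last by ring.
by rewrite -mulr_powR_div//; field; rewrite gt_eqF.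
Qed.

Theorem mainTheorem13 (R : realType) (n : nat) (hn : (2 <= n)%N)
    (P Q : 'I_n -> R) (hP : Gamma R n P) (hQ : Gamma R n Q) :
  (forall t : R, 2 <= t \/ t <= -1 -> agDiv P Q <= 1 / 8 * symDiv t P Q) /\
  (forall t : R, 0 <= t <= 1 -> agDiv P Q >= 1 / 8 * symDiv t P Q).
Proof.
have [[P0 _] [Q0 _]] := (hP, hQ).
rewrite agDiv_generator//; split=> t ht; rewrite symDiv_generator// mulr_sumr;
  apply: ler_sum => i _; have pq0 := divr_gt0 (P0 i) (Q0 i);
  rewrite (mulrCA (1 / 8)) ler_pM2l//.
- by have := @agGen_le R t _ ht pq0; lra.
- by have := @agGen_ge R t _ ht pq0; lra.
Qed.
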